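(* Let $n\ge 1$. Every Hadamard-free Clifford transformation over $n$ qubits can be implemented over the Linear Nearest Neighbor (LNN) architecture as a circuit with two-qubit gate depth at most $5n$.
   Context: Gates act on computational basis states ($x,y\in\{0,1\}$) by: Phase gate $P:|x\rangle\mapsto i^{x}|x\rangle$; $\mathrm{CZ}:|x,y\rangle\mapsto(-1)^{xy}|x,y\rangle$; $\mathrm{CNOT}:|x,y\rangle\mapsto|x,x\oplus y\rangle$ (first qubit is the control, second the target). A Hadamard-free Clifford transformation over $n$ qubits is a unitary on $n$ qubits that equals a finite product of $P$, $\mathrm{CZ}$ and $\mathrm{CNOT}$ gates applied to arbitrary qubits or pairs of qubits (these form a finite group). LNN architecture: the qubits are arranged on a line in positions $1,\dots,n$, and a two-qubit gate may be applied only to a pair of qubits in positions $\{k,k+1\}$, $1\le k\le n-1$ (for CNOT, with either one as control). The circuits are built from $P$ gates (on any qubit) and CNOT and CZ gates on adjacent qubits, and no ancillary qubits are used; the circuit must implement the given transformation exactly, without leftover permutation of the qubits. Two-qubit gate depth: the single-qubit gates are not counted; the two-qubit gate depth of a circuit is the least number $d$ such that its two-qubit gates can be arranged, compatibly with the circuit order, into $d$ consecutive layers where the two-qubit gates in one layer act on pairwise disjoint pairs of qubits (arbitrary single-qubit gates are allowed between layers). *)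

(* Defs.v *)
From HB Require Import structures.
From mathcomp Require Import all_boot all_order all_algebra.

Set Implicit Arguments.
Unset Strict Implicit.
Unset Printing Implicit Defensive.

Import GRing.Theory Num.Theory.
Local Open Scope ring_scope.

(* The qubit (line position) k = 1, ..., n is the ordinal k - 1
   of 'I_n. *)

Definition bits (n : nat) := {ffun 'I_n -> bool}.

Inductive gate (n : nat) : Type :=
| Phase of 'I_n
| CZ of 'I_n & 'I_n
| CNOT of 'I_n & 'I_n. (* CNOT control target *)

Definition two_qubit n (g : gate n) : bool :=
  if g is Phase _ then false else true.

Definition support n (g : gate n) : {set 'I_n} :=
  match g with
  | Phase q => [set q]
  | CZ q r | CNOT q r => [set q; r]
  end.

(* The connectivity e says to which pairs two-qubit gates may be applied. It is
   also what excludes the meaningless "gates" CZ q q and CNOT q q. *)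
Definition allowed n (e : rel 'I_n) (g : gate n) : bool :=
  match g with
  | Phase _ => true
  | CZ q r | CNOT q r => e q r
  end.

Definition all_to_all n : rel 'I_n := [rel q r | q != r].

Definition lnn n : rel 'I_n :=
  [rel q r | ((val q).+1 == val r) || ((val r).+1 == val q)].

Section Operators.

Variables (C : numClosedFieldType) (n : nat).

(* Operators on n qubits are matrices whose 2 ^ n rows and columns are indexed
   by the enumeration of the bit strings. *)
Definition ket (x : bits n) : 'cV[C]_#|{: bits n}| := delta_mx (enum_rank x) 0.

Definition gate_ket (g : gate n) (x : bits n) : 'cV[C]_#|{: bits n}| :=
  match g with
  | Phase q => 'i ^+ x q *: ket x
  | CZ q r => (-1) ^+ (x q * x r)%N *: ket x
  | CNOT c t => ket [ffun k => if k == t then x c (+) x t else x k]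
  end.

Definition gate_mx (g : gate n) : 'M[C]_#|{: bits n}| :=
  \sum_(x : bits n) gate_ket g x *m (ket x)^T.

Lemma gate_mx_ket g x : gate_mx g *m ket x = gate_ket g x.
Proof.
rewrite /gate_mx mulmx_suml (bigD1 x) //= big1 => [|y /negPf ne_yx].
  rewrite -mulmxA /ket trmx_delta mul_delta_mx addr0.
  rewrite (_ : delta_mx 0 0 = 1%:M) ?mulmx1 //.
  by apply/matrixP=> i j; rewrite !ord1 !mxE.
rewrite -mulmxA /ket trmx_delta mul_delta_mx_0 ?mulmx0 //.
by rewrite (inj_eq enum_rank_inj) ne_yx.
Qed.

(* Circuits are listed in order of application: the first gate acts first. *)
Fixpoint circuit_mx (s : seq (gate n)) : 'M[C]_#|{: bits n}| :=
  if s is g :: s' then circuit_mx s' *m gate_mx g else 1%:M.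

Definition implements (s : seq (gate n)) (U : 'M[C]_#|{: bits n}|) : Prop :=
  circuit_mx s = U.

Definition hadamard_free_clifford (U : 'M[C]_#|{: bits n}|) : Prop :=
  U \is unitarymx /\
  exists2 s : seq (gate n), all (allowed (@all_to_all n)) s & implements s U.

End Operators.

Section Depth.

Variable n : nat.

(* The circuit order is the partial order in which gates sharing a qubit keep
   their relative order. Two gates sharing a qubit cannot lie in one layer, so
   the order of their layers is strict. *)
Definition layering (t : seq (gate n)) d (l : {ffun 'I_(size t) -> 'I_d}) :=
  [forall p : 'I_(size t), forall q : 'I_(size t),
    (p < q)%N
      && ~~ [disjoint support (tnth (in_tuple t) p)
                    & support (tnth (in_tuple t) q)]
      ==> (l p < l q)%N].

Definition layerable (s : seq (gate n)) (d : nat) : bool :=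
  [exists l : {ffun 'I_(size (filter (@two_qubit n) s)) -> 'I_d}, layering l].

Lemma layerable_ex (s : seq (gate n)) : exists d, layerable s d.
Proof.
exists (size (filter (@two_qubit n) s)); apply/existsP; exists [ffun p => p].
by apply/forallP=> p; apply/forallP=> q; apply/implyP; rewrite !ffunE; case/andP.
Qed.

Definition two_qubit_depth (s : seq (gate n)) : nat := ex_minn (layerable_ex s).

End Depth.

(* Main.v *)
(* A circuit acts by |x> -> phi(x) |M x>, with M invertible over F_2 and phi a
   product of functions i^(u(x)), u a linear form. The wires are swept by n
   layers of boxes acting on adjacent pairs, in alternating parity, twice.

   Let M = B N, where N has zeros below its antidiagonal. The boxes of B have two
   CNOTs: every box replaces its lower row by the combination of its two rows
   that is best for all the ranks of lower right corners of the matrix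
   simultaneously, and these ranks decrease as if odd-even transposition
   were sorting a 0-1 sequence.

   The boxes producing N reverse the order of the wires. Each of them exchanges
   two labels p < q, possibly with an addition, and costs at most three two-qubit
   gates, even when it also contributes the phase (-1)^(u(x) v(x)), u and v being
   the forms carried by the two wires. Since u = x_q + (lower labels) and
   v = x_p + (lower labels), induction on p + q expresses every (-1)^(x_p x_q)
   by these phases. Together with the functions i^(x_j), contributed by an initial
   layer of phase gates, they generate all the functions i^(u(x)), because
   i^(a xor b) = i^a i^b (-1)^(ab). The total depth is 3n + 2n. *)

Require Import Defs.
From HB Require Import structures.
From mathcomp Require Import all_boot all_order all_algebra all_fingroup.
From mathcomp Require Import reals complex zify.

Set Implicit Arguments.
Unset Strict Implicit.
Unset Printing Implicit Defensive.

Import GRing.Theory Num.Theory.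
Local Open Scope ring_scope.

(** * Circuits as phased linear maps *)

(** Embeds gates into a type with decidable equality, which gives meaning to membership of a gate in
    a circuit. *)
Definition gate_code n (g : gate n) : 'I_n + ('I_n * 'I_n + 'I_n * 'I_n) :=
  match g with
  | Phase q => inl q
  | CZ q r => inr (inl (q, r))
  | CNOT c t => inr (inr (c, t))
  end.

Definition gate_decode n (c : 'I_n + ('I_n * 'I_n + 'I_n * 'I_n)) : gate n :=
  match c with
  | inl q => Phase q
  | inr (inl p) => CZ p.1 p.2
  | inr (inr p) => CNOT p.1 p.2
  end.

Lemma gate_codeK n : cancel (@gate_code n) (@gate_decode n).
Proof. by case. Qed.

HB.instance Definition _ n := Equality.copy (gate n) (can_type (@gate_codeK n)).

Section Simulation.

Variables (C : numClosedFieldType) (n : nat).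
Implicit Types (g : gate n) (s : seq (gate n)) (x : bits n).

Definition gate_run g x : bits n :=
  if g is CNOT c t then [ffun k => if k == t then x c (+) x t else x k] else x.

Definition gate_phase g x : C :=
  match g with
  | Phase q => 'i ^+ x q
  | CZ q r => (-1) ^+ (x q && x r)
  | CNOT _ _ => 1
  end.

Fixpoint run s x : bits n := if s is g :: s' then run s' (gate_run g x) else x.

Fixpoint phase s x : C :=
  if s is g :: s' then gate_phase g x * phase s' (gate_run g x) else 1.

Lemma gate_run_cnot (c t : 'I_n) x k :
  gate_run (CNOT c t) x k = if k == t then x c (+) x t else x k.
Proof. by rewrite ffunE. Qed.

Lemma run_cat s1 s2 x : run (s1 ++ s2) x = run s2 (run s1 x).
Proof. by elim: s1 x => //= g s1 IHs x. Qed.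

Lemma phase_cat s1 s2 x :
  phase (s1 ++ s2) x = phase s1 x * phase s2 (run s1 x).
Proof. by elim: s1 x => [|g s1 IHs] x /=; rewrite ?mul1r // IHs mulrA. Qed.

Lemma run_nseq_Phase k q x : run (nseq k (Phase q)) x = x.
Proof. by elim: k. Qed.

Lemma phase_nseq_Phase k q x :
  phase (nseq k (Phase q)) x = 'i ^+ (x q * k)%N.
Proof. by elim: k => [|k IHk]; rewrite ?muln0 //= IHk mulnS exprD. Qed.

Lemma circuit_mx_ket s x :
  circuit_mx C s *m ket C x = phase s x *: ket C (run s x).
Proof.
elim: s x => [|g s IHs] x /=; first by rewrite mul1mx scale1r.
rewrite -mulmxA gate_mx_ket -scalerA -IHs.
by case: g => [q|q r|c t] /=; rewrite ?scale1r -?scalemxAr ?mulnb.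
Qed.

Lemma eq_circuit_mx s1 s2 :
  run s1 =1 run s2 -> phase s1 =1 phase s2 -> circuit_mx C s1 = circuit_mx C s2.
Proof.
move=> eq_run eq_phase.
have eq_col j : col j (circuit_mx C s1) = col j (circuit_mx C s2).
  have ketE : delta_mx j 0 = ket C (enum_val j) by rewrite /ket enum_valK.
  by rewrite !colE ketE !circuit_mx_ket eq_run eq_phase.
by apply/matrixP=> i j; have /colP/(_ i) := eq_col j; rewrite !mxE.
Qed.

End Simulation.

(** * Schedules bounding the two-qubit depth *)

Section Depth.

Variable n : nat.
Implicit Types (g : gate n) (s : seq (gate n)).

Definition ordered (p q : gate n * nat) :=
  [&& two_qubit p.1, two_qubit q.1
    & ~~ [disjoint Defs.support p.1 & Defs.support q.1]]
  ==> (p.2 < q.2)%N.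

(** A schedule attaches a layer to every gate, a dummy one to Phase gates. Unlike [layering], which
    is indexed by ordinals, this form passes easily through concatenation. *)
Definition fits s d := exists t : seq (gate n * nat),
  [/\ map fst t = s, all (fun p => two_qubit p.1 ==> (p.2 < d)%N) t
    & pairwise ordered t].

Lemma fits_leq s d d' : (d <= d')%N -> fits s d -> fits s d'.
Proof.
move=> le_dd' [t [<- lt_t ord_t]]; exists t; split=> //.
by apply: sub_all lt_t => p /implyP lt_p; apply/implyP => /lt_p /leq_trans->.
Qed.

Lemma fits_cat s1 s2 d1 d2 :
  fits s1 d1 -> fits s2 d2 -> fits (s1 ++ s2) (d1 + d2).
Proof.
move=> [t1 [<- lt_t1 ord_t1]] [t2 [<- lt_t2 ord_t2]].
exists (t1 ++ [seq (p.1, d1 + p.2)%N | p <- t2]); split.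
- by rewrite map_cat -map_comp.
- rewrite all_cat all_map; apply/andP; split.
    by apply: sub_all lt_t1 => p; case: two_qubit => //=; lia.
  by apply: sub_all lt_t2 => p /=; case: two_qubit => //=; lia.
rewrite pairwise_cat ord_t1 pairwise_map; apply/and3P; split=> //; last first.
  by apply: sub_pairwise ord_t2 => p q; rewrite /ordered /= ltn_add2l.
apply/allrelP=> p q /(allP lt_t1) lt_p /mapP[q' _ ->] /=.
by apply/implyP=> /and3P[tp _ _]; move: lt_p; rewrite tp /=; lia.
Qed.

Lemma fits_par s1 s2 d : fits s1 d -> fits s2 d ->
  {in s1 & s2, forall g h, [disjoint Defs.support g & Defs.support h]} ->
  fits (s1 ++ s2) d.
Proof.
move=> [t1 [<- lt_t1 ord_t1]] [t2 [<- lt_t2 ord_t2]] dis12.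
exists (t1 ++ t2); rewrite map_cat all_cat lt_t1 pairwise_cat ord_t1 ord_t2.
split=> //; rewrite !andbT; apply/allrelP=> p q t1p t2q.
by rewrite /ordered dis12 ?andbF //; apply: map_f.
Qed.

Lemma fits_count s : fits s (count (@two_qubit n) s).
Proof.
elim: s => [|g s IHs]; first by exists [::].
rewrite -cat1s; apply: fits_cat IHs.
by exists [:: (g, 0%N)]; rewrite /= andbT; split=> //; case: two_qubit.
Qed.

Lemma two_qubit_depth_leq s d : fits s d -> (two_qubit_depth s <= d)%N.
Proof.
move=> [t [<- lt_t ord_t]]; rewrite /two_qubit_depth; case: ex_minnP=> m _; apply.
rewrite /layerable; set t' := filter (fun p => two_qubit p.1) t.
have -> : [seq g <- map fst t | two_qubit g] = map fst t' by rewrite filter_map.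
have {}lt_t : all (fun p => p.2 < d)%N t'.
  apply/allP=> p; rewrite mem_filter => /andP[tp /(allP lt_t)].
  by rewrite tp.
have {}ord_t : pairwise ordered t' by apply: pairwise_filter.
have two_t : all (fun p => two_qubit p.1) t' by apply: filter_all.
have lt_size (i : 'I_(size (map fst t'))) : (i < size t')%N.
  by have := ltn_ord i; rewrite [X in (_ < X)%N]size_map.
have lt_l (i : 'I_(size (map fst t'))) : (nth 0%N (map snd t') i < d)%N.
  have all_lt : all (fun m => m < d)%N (map snd t') by rewrite all_map.
  by apply: (all_nthP 0%N all_lt); rewrite [X in (_ < X)%N]size_map.
apply/existsP; exists [ffun i => Ordinal (lt_l i)].
apply/forallP=> i; apply/forallP=> j; apply/implyP; rewrite !ffunE /=.
have g0 := tnth (in_tuple (map fst t')) i; pose p0 := (g0, 0%N).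
have tnthE (k : 'I_(size (map fst t'))) :
    tnth (in_tuple (map fst t')) k = (nth p0 t' k).1.
  by rewrite (tnth_nth g0); apply: nth_map.
have nthE (k : 'I_(size (map fst t'))) :
    nth 0%N (map snd t') k = (nth p0 t' k).2 by apply: nth_map.
rewrite !tnthE !nthE => /andP[lt_ij clash_ij].
have := pairwiseP p0 ord_t i j (lt_size i) (lt_size j) lt_ij.
by rewrite /ordered clash_ij !(all_nthP p0 two_t).
Qed.

End Depth.

(** * Odd-even transposition networks *)

Section Network.

(** Abstract sorting, common to both sweeps: [f st J k] plays the number of ones from position [k]
    on in a 0-1 sequence with at most [J] ones, which are to move to the front. In the instances of
    [sem], circuits lead from the later state back to the earlier one, so new boxes are prepended.
    The index [I] lets one sequence of states carry a family of circuits. *)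
Variables (n : nat) (T I : Type) (inv : T -> Prop).
Variables (sem : T -> (I -> seq (gate n)) -> T -> Prop).
Variables (f : T -> nat -> nat -> nat) (d : nat).

Hypothesis sem_nil : forall st, sem st (fun=> [::]) st.
Hypothesis sem_cat : forall st1 st2 st3 s1 s2,
  sem st1 s1 st2 -> sem st2 s2 st3 -> sem st1 (fun i => s2 i ++ s1 i) st3.
Hypothesis f_leq_threshold : forall st J k, (J <= n)%N -> (f st J k <= J)%N.
Hypothesis f_leq_suffix : forall st J k, (f st J k <= n - k)%N.
(** Models a compare-exchange: [q] receives a one only if both positions held ones, and suffixes
    containing both positions or neither keep their counts. *)
Hypothesis box : forall st (p q : 'I_n), q = p.+1 :> nat -> inv st ->
  exists st' s,
  [/\ inv st', sem st s st',
      forall i, [/\ all (allowed (@lnn n)) (s i),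
        {in s i, forall g, Defs.support g \subset [set p; q]}
        & (count (@two_qubit n) (s i) <= d)%N],
      forall J, (J <= n)%N -> (f st' J q <= maxn (f st J p).-1 (f st J q.+1))%N
    & forall J k, k != q :> nat -> f st' J k = f st J k].

(* The layer of boxes at the positions [q] of parity [b]; the last condition on
   gates leaves the qubits of the next box of this layer untouched. *)
Lemma network_layer (b : bool) st m : (m <= n)%N -> inv st -> exists st' s,
  [/\ inv st', sem st s st',
      forall i, [/\ all (allowed (@lnn n)) (s i), fits (s i) d
        & {in s i, forall g, forall r, r \in Defs.support g ->
             (r + (odd m == b) < m)%N}]
    & forall J k, (J <= n)%N -> if (0 < k < m)%N && (odd k == b)
        then is_true (f st' J k <= maxn (f st J k.-1).-1 (f st J k.+1))%N
        else f st' J k = f st J k].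
Proof.
move=> le_mn inv0; elim: m le_mn => [_|m IHm lt_mn].
  exists st, (fun=> [::]); split=> //= [i|J k _]; last by rewrite andbF.
  by split=> //; exists [::].
have [st1 [s1 [inv1 sem1 s1P f1P]]] := IHm (ltnW lt_mn).
have [m0|m_gt0] := posnP m.
  exists st1, s1; split=> // [i|J k leJn].
    have [? ? s1i] := s1P i; split=> // g /s1i s1g r /s1g.
    by rewrite m0.
  by have := f1P J k leJn; rewrite m0 /=; case: k => [|k].
have [/eqP odd_m|odd_m] := boolP (odd m == b); last first.
  exists st1, s1; split=> // [i|J k leJn].
    have [? ? s1i] := s1P i; split=> // g /s1i s1g r /s1g.
    by rewrite (negPf odd_m) /=; case: (_ == b) => /=; lia.
  have := f1P J k leJn; have [->|ne_km] := eqVneq k m.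
    by rewrite ltnn (negPf odd_m) !andbF.
  by rewrite [(k < m.+1)%N]ltnS [(k <= m)%N]leq_eqVlt (negPf ne_km).
have lt_m1n : (m.-1 < n)%N by lia.
pose p := Ordinal lt_m1n; pose q := Ordinal lt_mn.
have def_q : q = p.+1 :> nat by rewrite /=; lia.
have [st2 [s2 [inv2 sem2 s2P f2P f2E]]] := box def_q inv1.
exists st2, (fun i => s2 i ++ s1 i); split=> // [|i|J k leJn].
- exact: sem_cat sem2.
- have [al1 fit1 sup1] := s1P i; have [al2 sup2 cnt2] := s2P i.
  have sup2' g : g \in s2 i -> forall r,
      r \in Defs.support g -> (m <= r.+1 <= m.+1)%N.
    by move=> /sup2/subsetP sub r /sub; rewrite !inE => /orP[]/eqP->/=; lia.
  split; first by rewrite all_cat al1 al2.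
    apply: fits_par fit1 _; first exact: fits_leq cnt2 (fits_count _).
    move=> g h s2g s1h; rewrite disjoint_subset; apply/subsetP=> r gr.
    apply/negP=> hr; have := sup2' _ s2g _ gr; have := sup1 _ s1h _ hr.
    by rewrite odd_m eqxx; lia.
  move=> g; rewrite mem_cat -odd_m /= => /orP[/sup2' s2g|/sup1 s1g] r.
    by move/s2g; case: odd => /=; lia.
  by move/s1g; case: odd => /=; lia.
have [->{k}|ne_km] := eqVneq k m.
  (* The neighbours [m.-1] and [m.+1] are not yet modified, by parity and by range, so the bound of
     the box is already a bound in terms of the initial state. *)
  have odd_pm : (odd m.-1 == b) = false.
    by rewrite -odd_m -[in odd m](prednK m_gt0) /=; case: odd.
  have := f1P J m.-1 leJn; have := f1P J m.+1 leJn; have := f2P J leJn.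
  rewrite odd_pm andbF [(m.+1 < m)%N]ltnNge leqnSn /= => le_f eq_next eq_prev.
  by rewrite m_gt0 ltnSn odd_m eqxx -eq_next -eq_prev.
rewrite f2E // [(k < m.+1)%N]ltnS [(k <= m)%N]leq_eqVlt (negPf ne_km) /=.
exact: f1P.
Qed.

(** Unless [f <= J - k] holds already, [2 f + k + t <= J + n] up to the slack. At [t = 0] this is
    the sum of the two a priori bounds; a layer improves it by one at an active position, through
    the bounds at [k - 1] and [k + 1]. For [t = n] it leaves [2 f + k <= J + 1], hence [f + k <= J]
    unless [f = 0]. *)
Lemma network_sorts st : inv st -> exists st' s,
  [/\ inv st', sem st s st',
      forall i, all (allowed (@lnn n)) (s i) /\ fits (s i) (d * n)
    & forall J k, (J <= n)%N -> (f st' J k <= J - k)%N].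
Proof.
move=> inv0.
(* The slack [~~ odd (k + t)] is for the positions that the last layer skipped. *)
suff main t : exists st' s,
    [/\ inv st', sem st s st',
      forall i, all (allowed (@lnn n)) (s i) /\ fits (s i) (d * t)
    & forall J k, (J <= n)%N -> (f st' J k <= J - k)%N
        \/ (2 * f st' J k + k + t <= J + n + ~~ odd (k + t))%N].
  have [st' [s [inv' sem' s' f']]] := main n.
  exists st', s; split=> // J k leJn.
  by case: (f' J k leJn) => //; case: odd => /=; lia.
elim: t => [|t [st1 [s1 [inv1 sem1 s1P f1P]]]].
  exists st, (fun=> [::]); split=> // [i|J k leJn].
    by rewrite muln0; split=> //; exists [::].
  have := f_leq_threshold st k leJn; have := f_leq_suffix st J k; lia.
have [st2 [s2 [inv2 sem2 s2P f2P]]] := network_layer (odd t) (leqnn n) inv1.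
exists st2, (fun i => s2 i ++ s1 i); split=> // [|i|J k leJn].
- exact: sem_cat sem2.
- have [al1 fit1] := s1P i; have [al2 fit2 _] := s2P i.
  by rewrite all_cat al1 al2 mulnS; split=> //; apply: fits_cat.
have := f2P J k leJn; case: ifP.
  move=> /andP[/andP[k_gt0 lt_kn] /eqP odd_k].
  have oddp : odd (k.-1 + t) by rewrite oddD -odd_k -oddD; lia.
  have oddq : odd (k.+1 + t) by rewrite oddD -odd_k -oddD; lia.
  have := f1P J k.-1 leJn; have := f1P J k.+1 leJn.
  by rewrite oddp oddq (_ : odd (k + t.+1)) ?addnS -?addSn ?oddq /=; lia.
move=> inactive ->; have [k0|k_gt0] := posnP k.
  by left; rewrite k0 subn0 f_leq_threshold.
have [lt_kn|le_nk] := ltnP k n; last first.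
  by left; have := f_leq_suffix st1 J k; lia.
(* Skipped by parity: [k + t] is odd, so the slack goes from 0 to 1 and absorbs the increase of
   [t]. *)
move: inactive; rewrite k_gt0 lt_kn /= => /eqP odd_k.
have odd_kt : odd (k + t) by rewrite oddD; move: odd_k; do 2!case: odd.
by have := f1P J k leJn; rewrite addnS /= odd_kt /=; lia.
Qed.

End Network.

(** * Reduction to a triangular matrix *)

Section LinearMaps.

Variable n : nat.
Implicit Types (M : 'M[bool]_n) (u v : 'rV[bool]_n) (x : bits n).

(** Here [bool] is the field with two elements: addition is xor and multiplication is
    conjunction. *)
Definition dot u x : bool := \sum_j u 0 j * x j.

Definition app M x : bits n := [ffun i => dot (row i M) x].

(** For [p = q] the row [u] prevails; [gate_lin] replaces a single row in this way. *)
Definition set_rows M (p q : 'I_n) u v : 'M[bool]_n :=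
  \matrix_(r, j) (if r == p then u 0 j else if r == q then v 0 j else M r j).

Lemma dotD u v x : dot (u + v) x = dot u x (+) dot v x.
Proof. by rewrite -big_split; apply: eq_bigr => j _; rewrite mxE mulrDl. Qed.

Lemma row_set_rows M p q u v r : row r (set_rows M p q u v) =
  if r == p then u else if r == q then v else row r M.
Proof. by apply/rowP=> j; rewrite !mxE; do 2?case: ifP => _; rewrite ?mxE. Qed.

Lemma app_set_rows M p q u v x r : app (set_rows M p q u v) x r =
  if r == p then dot u x else if r == q then dot v x else app M x r.
Proof. by rewrite !ffunE row_set_rows; do 2?case: ifP => _. Qed.

Lemma row_copid M k r :
  row r (copid_mx k *m M) = if (k <= r)%N then row r M else 0.
Proof.
rewrite /copid_mx mulmxBl mul1mx; apply/rowP=> j; rewrite !mxE (bigD1 r) //=.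
rewrite big1 => [|i ne_ir]; last first.
  by rewrite mxE [(r == i :> nat)]eq_sym [_ == _](negPf ne_ir) mul0r.
rewrite mxE eqxx addr0 ltnNge; case: leqP => /= _; rewrite mxE.
  by rewrite mul0r subr0.
by rewrite mul1r subrr.
Qed.

Lemma copid_subP M k m (B : 'M[bool]_(m, n)) :
  reflect (forall r : 'I_n, (k <= r)%N -> (row r M <= B)%MS)
          (copid_mx k *m M <= B)%MS.
Proof.
apply: (iffP row_subP) => sub r; last first.
  by rewrite row_copid; case: ifP => [/sub|]; rewrite ?sub0mx.
by move=> le_kr; have := sub r; rewrite row_copid le_kr.
Qed.

Lemma row_sub_copid M k (r : 'I_n) :
  (k <= r)%N -> (row r M <= copid_mx k *m M)%MS.
Proof. exact/copid_subP. Qed.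

Lemma copid_set_rows_sub M p q u v k :
  (u <= copid_mx k *m M)%MS -> (v <= copid_mx k *m M)%MS ->
  (copid_mx k *m set_rows M p q u v <= copid_mx k *m M)%MS.
Proof.
move=> sub_u sub_v; apply/copid_subP=> r le_kr; rewrite row_set_rows.
by do 2?case: ifP => // _; apply: row_sub_copid.
Qed.

Lemma copid_mul a b : (a <= b)%N ->
  copid_mx a *m copid_mx b = copid_mx b :> 'M[bool]_n.
Proof.
move=> le_ab; rewrite /copid_mx mulmxBl mul1mx mulmxBr mulmx1.
rewrite mul_pid_mx; set m := minn n (minn a b).
have -> : pid_mx m = pid_mx a :> 'M[bool]_n.
  by rewrite /m (minn_idPl le_ab) pid_mx_minh.
by rewrite subrr subr0.
Qed.

End LinearMaps.

(** * Ranks of lower right corners *)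

Section RankReduction.

Variable n : nat.
Implicit Types (M : 'M[bool]_n) (x : bits n).

(** The block consists of the rows from [k] on and the last [J] columns. Projections in place of
    submatrices keep all sizes equal to [n]. *)
Definition corner_rank M J k :=
  \rank (copid_mx k *m M *m copid_mx (n - J)).

Lemma corner_rank_leq_threshold M J k : (J <= n)%N -> (corner_rank M J k <= J)%N.
Proof.
move=> le_Jn; apply: leq_trans (mxrankM_maxr _ _) _.
by rewrite rank_copid_mx ?leq_subr // subKn.
Qed.

Lemma corner_rank_leq_suffix M J k : (corner_rank M J k <= n - k)%N.
Proof.
rewrite /corner_rank -mulmxA; apply: leq_trans (mxrankM_maxl _ _) _.
have [le_kn|lt_nk] := leqP k n; first by rewrite rank_copid_mx.
rewrite (_ : copid_mx k = 0) ?mxrank0 //.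
rewrite -[copid_mx k]mulmx1; apply/row_matrixP=> r.
by rewrite row_copid row0 leqNgt (ltn_trans (ltn_ord r)).
Qed.

(** Over two elements, [a], [b] and [a + b] are all the nonzero combinations of [a] and [b], so the
    hypotheses say that [a] and [b] are independent modulo [S]. *)
Lemma mxrank_adds_two m (S : 'M[bool]_(m, n)) (a b : 'rV[bool]_n) :
  ~~ (a <= S)%MS -> ~~ (b <= S)%MS -> ~~ ((a + b)%R <= S)%MS ->
  ((\rank S).+2 <= \rank (S + b + a))%N.
Proof.
move=> notSa notSb notSab.
have lt1 : (S < S + b)%MS.
  rewrite ltmxE addsmxSl; apply: contra notSb; apply: submx_trans.
  exact: addsmxSr.
have lt2 : (S + b < S + b + a)%MS.
  rewrite ltmxE addsmxSl; apply/negP=> sub.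
  have /sub_addsmxP[[w c] /= def_a] := submx_trans (addsmxSr _ _) sub.
  have c_b : c *m b = 0 \/ c *m b = b.
    rewrite [c]mx11_scalar mul_scalar_mx; case: (c 0 0) => [|]; [right|left].
      exact: scale1r.
    exact: scale0r.
  case: c_b def_a => [->|->] def_a.
    by case/negP: notSa; rewrite def_a addr0 submxMl.
  case/negP: notSab; rewrite def_a -addrA (_ : b + b = 0) ?addr0 ?submxMl //.
  by apply/rowP=> j; rewrite !mxE; case: (b _ _).
exact: leq_ltn_trans (rank_ltmx lt1) (rank_ltmx lt2).
Qed.

(* The combinations which are dependent on the rows below [q], once truncated to
   the last [J] columns, can only become fewer as [J] grows; so one that stays
   dependent longest serves all [J]. *)
Lemma best_combination M (p q : 'I_n) :
  exists2 c, c \in [:: row q M; row p M; row p M + row q M] &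
    forall J, (J <= n)%N ->
      (exists2 c', c' \in [:: row q M; row p M; row p M + row q M] &
         (c' *m copid_mx (n - J) <= copid_mx q.+1 *m M *m copid_mx (n - J))%MS) ->
      (c *m copid_mx (n - J) <= copid_mx q.+1 *m M *m copid_mx (n - J))%MS.
Proof.
set cs := [:: _; _; _]; set S := copid_mx q.+1 *m M.
suff H N : (N <= n)%N -> exists2 c, c \in cs & forall J, (J <= N)%N ->
    (exists2 c', c' \in cs & (c' *m copid_mx (n - J) <= S *m copid_mx (n - J))%MS)
    -> (c *m copid_mx (n - J) <= S *m copid_mx (n - J))%MS.
  exact: H.
have mono J J' c : (J <= J')%N ->
    (c *m copid_mx (n - J') <= S *m copid_mx (n - J'))%MS ->
    (c *m copid_mx (n - J) <= S *m copid_mx (n - J))%MS.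
  move=> leJ sub; have le_nJ : (n - J' <= n - J)%N by apply: leq_sub2l.
  by rewrite -(copid_mul _ le_nJ) !mulmxA submxMr.
elim: N => [_|N IHN lt_Nn].
  exists (row q M); [exact: mem_head | move=> J].
  rewrite leqn0 => /eqP-> _; rewrite subn0.
  by rewrite /copid_mx pid_mx_1 subrr !mulmx0 sub0mx.
(* A combination dependent at [N.+1] is so for all smaller [J]. If there is none, the new case is
   vacuous and the previous choice stands. *)
have [has_c|no_c] := boolP (has
  (fun c => c *m copid_mx (n - N.+1) <= S *m copid_mx (n - N.+1))%MS cs).
  by have /hasP[c cs_c sub_c] := has_c; exists c => // J leJ _; apply: mono sub_c.
have [c cs_c sub_c] := IHN (ltnW lt_Nn); exists c => // J.
rewrite leq_eqVlt => /orP[/eqP-> [c' cs_c' sub_c']|]; last exact: sub_c.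
by case/hasP: no_c; exists c'.
Qed.

(** For each [J], either the new row [q] depends on the rows below, and the rank at [q] drops to
    that at [q.+1]; or no combination does, and the rank at [p] exceeds that at [q.+1] by two while
    the new row accounts for only one. *)
Lemma corner_rank_box M (p q : 'I_n) : q = p.+1 :> nat ->
  exists M' (s : seq (gate n)),
  [/\ forall x, app M x = run s (app M' x),
      s \in [:: [::]; [:: CNOT p q]; [:: CNOT p q; CNOT q p]],
      (M <= M')%MS,
      forall J, (J <= n)%N -> (corner_rank M' J q <=
        maxn (corner_rank M J p).-1 (corner_rank M J q.+1))%N
    & forall J k, k != q :> nat -> corner_rank M' J k = corner_rank M J k].
Proof.
move=> def_q; set a := row p M; set b := row q M.
have [c cs_c sub_c] := best_combination M p q; rewrite -/a -/b in cs_c sub_c.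
have ne_qp : q != p by rewrite -val_eqE /= def_q gtn_eqF.
have ne_pq : p != q by rewrite eq_sym.
have bb0 (w : 'rV[bool]_n) : w + w = 0.
  by apply/rowP=> j; rewrite !mxE; case: (w _ _).
have sub_ab e1 e2 : ((e1 *: a + e2 *: b)%R <= a + b)%MS.
  by rewrite addmx_sub_adds // scalemx_sub.
(* The row [u] completes [c] to a basis change of the two rows that at most two CNOTs undo: [u = a]
   for [c = b] or [c = a + b], and [u = a + b] for [c = a]. *)
have [u [s [runM' sP sub_u sub_a sub_b]]] : exists u (s : seq (gate n)),
    [/\ forall x, app M x = run s (app (set_rows M p q u c) x),
      s \in [:: [::]; [:: CNOT p q]; [:: CNOT p q; CNOT q p]],
      (u <= a + b)%MS, (a <= u + c)%MS & (b <= u + c)%MS].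
  move: cs_c; rewrite !inE => /or3P[]/eqP->.
  - exists a, [::]; split; rewrite ?addsmxSl ?addsmxSr ?mem_head // => x.
    apply/ffunP=> r; rewrite app_set_rows /a /b.
    by have [->|_] := eqVneq r p; [|have [->|_] := eqVneq r q]; rewrite ?ffunE.
  - exists (a + b), [:: CNOT p q; CNOT q p]; split.
    + move=> x; apply/ffunP=> r.
      rewrite !gate_run_cnot !app_set_rows !eqxx (negPf ne_qp) (negPf ne_pq).
      have [->|_] := eqVneq r p.
        rewrite dotD ffunE -/a.
        by case: (dot a x) (dot b x) => -[].
      have [->|//] := eqVneq r q.
      by rewrite dotD ffunE -/b; case: (dot a x) (dot b x) => -[].
    + by rewrite !inE eqxx !orbT.
    + by have := sub_ab 1 1; rewrite !scale1r.
    + by rewrite addsmxSr.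
    + rewrite [X in (X <= _)%MS](_ : b = (a + b) + a).
        by rewrite addmx_sub_adds.
      by rewrite addrC addrA bb0 add0r.
  - exists a, [:: CNOT p q]; split.
    + move=> x; apply/ffunP=> r.
      rewrite !gate_run_cnot !app_set_rows !eqxx (negPf ne_qp).
      have [->|_] := eqVneq r q; last first.
        by have [->|//] := eqVneq r p; rewrite ffunE.
      rewrite dotD ffunE -/b.
      by case: (dot a x) (dot b x) => -[].
    + by rewrite !inE eqxx !orbT.
    + by rewrite addsmxSl.
    + by rewrite addsmxSl.
    + rewrite [X in (X <= _)%MS](_ : b = a + (a + b)).
        by rewrite addmx_sub_adds.
      by rewrite addrA bb0 add0r.
have sub_c' : (c <= a + b)%MS.
  move: cs_c; rewrite !inE => /or3P[]/eqP->; rewrite ?addsmxSl ?addsmxSr //.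
  by have := sub_ab 1 1; rewrite !scale1r.
set M' := set_rows M p q u c in runM' *.
have defM : M = set_rows M' p q a b.
  apply/row_matrixP=> r; rewrite !row_set_rows.
  by have [->|_] := eqVneq r p; [|have [->|_] := eqVneq r q].
have rowMp : row p M' = u by rewrite row_set_rows eqxx.
have rowMq : row q M' = c by rewrite row_set_rows eqxx (negPf ne_qp).
have eq_copid k : (k <= p)%N -> (copid_mx k *m M' :=: copid_mx k *m M)%MS.
  move=> le_kp; have le_kq : (k <= q)%N by rewrite def_q ltnW.
  have sub_M w (A : 'M[bool]_n) : (w <= row p A + row q A)%MS ->
      (w <= copid_mx k *m A)%MS.
    by move/submx_trans; apply; rewrite addsmx_sub !row_sub_copid.
  apply/eqmxP/andP; split.
    by apply: copid_set_rows_sub; apply: sub_M.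
  rewrite defM.
  by apply: copid_set_rows_sub; apply: sub_M; rewrite rowMp rowMq.
have eq_copid_lt k : (q < k)%N -> copid_mx k *m M' = copid_mx k *m M.
  move=> lt_qk; apply/row_matrixP=> r; rewrite !row_copid row_set_rows.
  case: leqP => // le_kr; have lt_qr := leq_trans lt_qk le_kr.
  by rewrite -!val_eqE /= !gtn_eqF // (leq_trans _ lt_qr) // def_q.
exists M', s; split=> //.
- have := eq_copid 0 (leq0n p); rewrite /copid_mx pid_mx_0 subr0 !mul1mx => eqM.
  by rewrite eqM.
- move=> J le_Jn; rewrite leq_max.
  have sub_q : (copid_mx q *m M' <= c + copid_mx q.+1 *m M)%MS.
    apply/copid_subP=> r; rewrite leq_eqVlt => /orP[/eqP/val_inj <-|lt_qr].
      by rewrite rowMq addsmxSl.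
    apply: submx_trans (addsmxSr _ _); rewrite -eq_copid_lt //.
    exact: row_sub_copid.
  have {}sub_q : (copid_mx q *m M' *m copid_mx (n - J) <=
      c *m copid_mx (n - J) + copid_mx q.+1 *m M *m copid_mx (n - J))%MS.
    by rewrite -addsmxMr submxMr.
  have [sub|notsub] := boolP
    (c *m copid_mx (n - J) <= copid_mx q.+1 *m M *m copid_mx (n - J))%MS.
    apply/orP; right; apply: mxrankS; apply: submx_trans sub_q _.
    by rewrite addsmx_sub sub submx_refl.
  apply/orP; left; set S := (copid_mx q.+1 *m M *m _)%MS in sub_q notsub.
  have no_c c' : c' \in [:: b; a; a + b] -> ~~ (c' *m copid_mx (n - J) <= S)%MS.
    by move=> cs_c'; apply: contra notsub => sub_S; apply: sub_c => //; exists c'.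
  have le2 : ((\rank S).+2 <= corner_rank M J p)%N.
    apply: leq_trans (mxrankS _); first apply: (@mxrank_adds_two _ S
      (a *m copid_mx (n - J)) (b *m copid_mx (n - J))).
    + by apply: no_c; rewrite !inE eqxx ?orbT.
    + by apply: no_c; rewrite !inE eqxx ?orbT.
    + by rewrite -mulmxDl; apply: no_c; rewrite !inE eqxx ?orbT.
    rewrite !addsmx_sub; apply/andP; split; first (apply/andP; split);
      apply: submxMr; rewrite ?row_sub_copid ?def_q //.
    by apply/copid_subP=> r lt_qr; apply: row_sub_copid; lia.
  have := mxrankS sub_q; have := (mxrank_adds_leqif (c *m copid_mx (n - J)) S).1.
  have := rank_leq_row (c *m copid_mx (n - J)); rewrite -/(corner_rank M' J q); lia.
move=> J k; rewrite /corner_rank neq_ltn => /orP[lt_kq|lt_qk].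
  have le_kp : (k <= p)%N by rewrite -ltnS -def_q.
  by rewrite (eqmxMr _ (eq_copid _ le_kp)).
by rewrite eq_copid_lt.
Qed.

End RankReduction.

(** * Clearing the entries below the antidiagonal *)

Section Triangularization.

Variables (C : numClosedFieldType) (n : nat).
Implicit Types (M N : 'M[bool]_n) (x : bits n).


Lemma mulmx_copid_entry M k i (j : 'I_n) :
  (k <= j)%N -> (M *m copid_mx k) i j = M i j.
Proof.
move=> le_kj; have tr_eq : (M *m copid_mx k)^T = copid_mx k *m M^T.
  by rewrite trmx_mul /copid_mx linearB /= trmx1 tr_pid_mx.
have /rowP/(_ i) := row_copid M^T k j.
by rewrite -tr_eq le_kj !mxE.
Qed.

Lemma adjacent_lnn (p q : 'I_n) : q = p.+1 :> nat -> lnn p q.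
Proof. by move=> def_q; rewrite /lnn /= -[val q]/(nat_of_ord q) def_q eqxx. Qed.

Lemma adjacent_lnn_sym (p q : 'I_n) : q = p.+1 :> nat -> lnn q p.
Proof. by move=> /adjacent_lnn; rewrite /lnn /= orbC. Qed.

Lemma triangularize M : row_full M -> exists N s,
  [/\ all (allowed (@lnn n)) s, fits s (2 * n),
      forall x, app M x = run s (app N x) /\ phase C s (app N x) = 1,
      row_full N & forall i j : 'I_n, N i j -> (i + j < n)%N].
Proof.
pose sem M1 (s : unit -> seq (gate n)) M2 := forall x,
  app M1 x = run (s tt) (app M2 x) /\ phase C (s tt) (app M2 x) = 1.
move=> fullM.
have [||st J k leJn|st J k|M1 p q def_q full1|//|N [s [fullN semN sP rankN]]] :=
  @network_sorts n _ unit (fun M => row_full M) sem (@corner_rank n) 2 _ _ _ _ _ M.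
- by [].
- move=> M1 M2 M3 s1 s2 sem1 sem2 x; have [run1 ph1] := sem1 x.
  have [run2 ph2] := sem2 x.
  by rewrite run_cat phase_cat -run2 ph2 ph1 mul1r.
- exact: corner_rank_leq_threshold.
- exact: corner_rank_leq_suffix.
- have [M2 [s [run2 sP sub12 rank_q rank_k]]] := corner_rank_box M1 def_q.
  exists M2, (fun=> s); split=> //.
  + by rewrite -sub1mx; apply: submx_trans sub12; rewrite sub1mx.
  + move=> x; split=> //.
    by move: sP; rewrite !inE => /or3P[]/eqP-> /=; rewrite ?mulr1.
  + move=> _; move: sP; rewrite !inE => /or3P[]/eqP->; split=> //=.
    * by rewrite adjacent_lnn.
    * by move=> g; rewrite inE => /eqP->.
    * by rewrite adjacent_lnn // adjacent_lnn_sym.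
    * by move=> g; rewrite !inE => /orP[]/eqP-> //=; rewrite setUC.
exists N, (s tt); have [al fit] := sP tt; split=> // i j Nij.
(* The sorted bound with [J = k = i] annihilates the rows from [i] on in the last [i] columns, a
   block containing [(i, j)] when [n <= i + j]. *)
rewrite ltnNge; apply/negP=> le_nij.
have le_in : (i <= n)%N by apply: ltnW.
have := rankN i i le_in; rewrite subnn leqn0 mxrank_eq0 => /eqP/matrixP/(_ i j).
rewrite mulmx_copid_entry; last by rewrite leq_subLR.
have /rowP/(_ j) := row_copid N i i; rewrite leqnn mxE => ->.
by rewrite !mxE Nij.
Qed.

End Triangularization.

(** * Reversal of the wires *)

Section Reversal.

Variables (C : numClosedFieldType) (n : nat).
Implicit Types (M N : 'M[bool]_n) (s : 'S_n) (x : bits n).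

Let pair := ('rV[bool]_n * 'rV[bool]_n)%type.
Implicit Types (L : seq pair) (c : pair -> nat).

(* [undup]: the phases of a pair occurring twice would cancel. *)
Definition pair_phase L c x : C :=
  \prod_(p <- undup L) (-1) ^+ ((dot p.1 x && dot p.2 x) * c p)%N.

Definition pivot (u : 'rV[bool]_n) (j : 'I_n) :=
  u 0 j /\ forall k : 'I_n, u 0 k -> (k <= j)%N.

(* The wire in position [i] carries the label [s i]; besides the pivot [s i],
   row [i] may only involve labels that still have to be exchanged with it. *)
Definition rothe M s :=
  (forall i, M i (s i)) /\
  (forall i r, M i (s r) -> (i <= r)%N && (s r <= s i)%N).

(** Labels start in decreasing order, so two labels in increasing order have been exchanged; [L]
    records the forms on their wires at that moment. *)
Definition met L s := forall i r : 'I_n, (i < r)%N -> (s i < s r)%N ->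
  exists2 p, p \in L & pivot p.1 (s r) /\ pivot p.2 (s i).

(** The 0-1 principle: labels below [J] are the ones to be sorted to the front. *)
Definition small_labels s J k := (\sum_(i < n | k <= i) (s i < J))%N.

Lemma small_labels_leq_threshold s J k :
  (J <= n)%N -> (small_labels s J k <= J)%N.
Proof.
move=> leJn; apply: (@leq_trans (\sum_(i < n) (s i < J))%N).
  by rewrite [leqRHS](bigID (fun i : 'I_n => (k <= i)%N)) leq_addr.
have -> : (\sum_(i < n) (s i < J) = \sum_(j < n | j < J) 1)%N.
  rewrite [RHS]big_mkcond [RHS](reindex_perm s).
  by apply: eq_bigr => i _; case: ltnP.
by rewrite (big_ord_narrow leJn) /= sum1_card card_ord.
Qed.

Lemma small_labels_leq_suffix s J k : (small_labels s J k <= n - k)%N.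
Proof.
apply: (@leq_trans (\sum_(i < n | k <= i) 1)%N).
  by apply: leq_sum => i _; apply: leq_b1.
rewrite -(big_mkord (fun i => k <= i)%N (fun=> 1%N)).
have [le_kn|lt_nk] := leqP k n.
  rewrite (big_cat_nat (n := k)) //= big_nat_cond big1 => [|i]; last by lia.
  rewrite add0n big_nat_cond (eq_bigl (fun i => k <= i < n)%N) => [|i]; last lia.
  by rewrite -big_nat sum_nat_const_nat muln1.
by rewrite big_nat_cond big1 // => i; lia.
Qed.

Lemma small_labelsS s J (q : 'I_n) :
  small_labels s J q = ((s q < J) + small_labels s J q.+1)%N.
Proof.
rewrite /small_labels (bigD1 q) //=; congr addn; apply: eq_bigl => i.
by rewrite ltn_neqAle andbC eq_sym.
Qed.

Section Swap.

Variables (p q : 'I_n).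
Hypothesis def_q : q = p.+1 :> nat.

Lemma tperm_cases (i : 'I_n) :
  [\/ i = p /\ tperm p q i = q, i = q /\ tperm p q i = p
    | [/\ i <> p, i <> q, (i < p)%N || (q < i)%N & tperm p q i = i]].
Proof.
case: tpermP => [->|->|ne_ip ne_iq]; [by constructor 1|by constructor 2|].
constructor 3; split=> //.
have /eqP := ne_ip; have /eqP := ne_iq; rewrite -!val_eqE /= def_q; lia.
Qed.

Lemma small_labels_swap s J k : k != q :> nat ->
  small_labels (tperm p q * s)%g J k = small_labels s J k.
Proof.
move=> ne_kq; rewrite /small_labels [RHS](reindex_perm (tperm p q)).
apply: eq_big => i; rewrite ?permM //.
by case: (tperm_cases i) => [[-> ->]|[-> ->]|[_ _ ? ->]] //; lia.
Qed.

(** The label [s q] moves to the left of [s p], so the wire carrying [s p] may no longer involve it;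
    the addition cancels this entry, as [M q (s q)] is 1. *)
Lemma rothe_swap M s : (s q < s p)%N -> rothe M s ->
  rothe (set_rows M p q (row q M) (row p M + M p (s q) *: row q M))
        (tperm p q * s)%g.
Proof.
move=> lt_s [diagM suppM].
have ne_qp : q == p = false by rewrite -val_eqE /= def_q; lia.
have Mqp : M q (s p) = false.
  by apply/negP => /suppM /andP[+ _]; rewrite def_q ltnn.
split=> [i|i r]; rewrite !permM mxE.
  case: (tperm_cases i) => [[-> ->]|[-> ->]|[/eqP/negPf-> /eqP/negPf-> _ ->]] //.
    by rewrite eqxx mxE.
  by rewrite ne_qp eqxx !mxE Mqp mulr0 addr0.
case: (tperm_cases i) => [[-> ->]|[-> ->]|[/eqP/negPf-> /eqP/negPf-> lt_i ->]].
- rewrite eqxx mxE => /suppM.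
  by case: (tperm_cases r) => [[-> ->]|[-> ->]|[_ _ ? ->]] //; lia.
- rewrite ne_qp eqxx !mxE.
  have [->|ne_rp] := eqVneq r p.
    by rewrite tpermL diagM; case: (M p (s q)).
  case: (boolP (M p (s (tperm p q r)))) => [/suppM le_p _|_].
    move: le_p ne_rp; rewrite -val_eqE /=.
    by case: (tperm_cases r) => [[-> ->]|[-> ->]|[_ _ ? ->]] //; lia.
  rewrite add0r => /andP[_ /suppM].
  move: ne_rp; rewrite -val_eqE /=.
  by case: (tperm_cases r) => [[-> ->]|[-> ->]|[_ _ ? ->]] //; lia.
move/suppM; case: (tperm_cases r) => [[-> ->]|[-> ->]|[_ _ ? ->]] //; lia.
Qed.

(** Only the exchanged pair becomes increasing, and [rothe] makes the labels of the two wires the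
    pivots of their rows. *)
Lemma met_swap L M s : rothe M s -> met L s ->
  met ((row p M, row q M) :: L) (tperm p q * s)%g.
Proof.
move=> [diagM suppM] metL i r lt_ir; rewrite !permM => lt_s.
have pivM k : pivot (row k M) (s k).
  split=> [|j]; rewrite mxE // -[j](permKV s) => /suppM/andP[].
  by [].
have [lt_t|] := ltnP (tperm p q i) (tperm p q r).
  have [w Lw piv_w] := metL _ _ lt_t lt_s.
  by exists w; rewrite // inE Lw orbT.
case: (tperm_cases i) lt_ir => [[-> ->]|[-> ->]|[_ _ lt_i ->]];
  case: (tperm_cases r) => [[-> ->]|[-> ->]|[_ _ lt_r ->]] lt_ir le_t; try lia.
by exists (row p M, row q M); [apply: mem_head | split; apply: pivM].
Qed.

(* Undoes the addition of [e] times the old row [q] to the old row [p], and their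
   exchange. For [f], the phase is a CZ if [e]; otherwise, it comes from Phase
   gates on [a], [b] and [a (+) b], as [i^a i^b i^(3 (a (+) b)) = (-1)^(a b)]. *)
Definition swap_gates (e f : bool) : seq (gate n) :=
  if e then [:: CNOT q p; CNOT p q] ++ nseq f (CZ p q)
  else nseq f (Phase p) ++ nseq f (Phase q) ++ [:: CNOT q p] ++
       nseq (f * 3) (Phase p) ++ [:: CNOT p q; CNOT q p].

(** With [e], two CNOTs suffice and leave room for a CZ. Without [e], the exchange takes three
    CNOTs, and after the first one wire [p] carries the sum needed by the Phase gates. *)
Lemma swap_gates_correct M (e f : bool) (t := swap_gates e f) :
  [/\ all (allowed (@lnn n)) t,
      {in t, forall g, Defs.support g \subset [set p; q]},
      (count (@two_qubit n) t <= 3)%N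
    & forall x,
        let y := app (set_rows M p q (row q M) (row p M + e *: row q M)) x in
        app M x = run t y /\
        phase C t y = (-1) ^+ ((dot (row p M) x && dot (row q M) x) * f)%N].
Proof.
rewrite {}/t /swap_gates.
have ne_qp : q == p = false by rewrite -val_eqE /= def_q; lia.
have ne_pq : p == q = false by rewrite eq_sym.
have adj := adjacent_lnn def_q; have adj' := adjacent_lnn_sym def_q.
have swap_pq : [set q; p] = [set p; q] :> {set 'I_n} by rewrite setUC.
case: e.
  split.
  - by case: f => /=; rewrite ?adj ?adj'.
  - by apply/allP; case: f; rewrite /= ?swap_pq ?subxx.
  - by case: f.
  move=> x; set y := app (set_rows _ _ _ _ _) x.
  set A := dot (row p M) x; set B := dot (row q M) x.
  have yp : y p = B by rewrite app_set_rows eqxx.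
  have yq : y q = A (+) B by rewrite app_set_rows ne_qp eqxx dotD scale1r.
  have out : app M x = run [:: CNOT q p; CNOT p q] y.
    apply/ffunP=> r; rewrite !gate_run_cnot !eqxx ne_qp yp yq app_set_rows.
    have [->|_] := eqVneq r q; last have [->|//] := eqVneq r p.
      by rewrite ffunE -/B; case: (A) (B) => -[].
    by rewrite ffunE -/A; case: (A) (B) => -[].
  rewrite run_cat phase_cat -out; split; first by case: f.
  rewrite /= !mul1r; case: f => /=; rewrite ?muln1 ?muln0 ?mulr1 //.
  by rewrite !ffunE.
split.
- by case: f => /=; rewrite ?adj ?adj'.
- by apply/allP; case: f; rewrite /= ?swap_pq ?sub1set ?inE ?subxx ?eqxx ?orbT.
- by case: f.
move=> x; set y := app (set_rows _ _ _ _ _) x.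
set A := dot (row p M) x; set B := dot (row q M) x.
have yp : y p = B by rewrite app_set_rows eqxx.
have yq : y q = A.
  by rewrite app_set_rows ne_qp eqxx scale0r addr0.
rewrite !run_cat !phase_cat !run_nseq_Phase !phase_nseq_Phase; split.
  apply/ffunP=> r; rewrite /run !gate_run_cnot !eqxx ne_qp ne_pq yp yq app_set_rows.
  have [->|_] := eqVneq r p; last have [->|//] := eqVneq r q.
    by rewrite ffunE -/A; case: (A) (B) => -[].
  by rewrite ffunE -/B; case: (A) (B) => -[].
rewrite /= yp yq ffunE eqxx !mul1r !mulr1.
have i2 : 'i ^+ 2 = -1 :> C by apply: sqrCi.
have i4 : 'i ^+ 4 = 1 :> C by rewrite (exprM _ 2 2) i2 sqrrN expr1n.
by case: f (A) (B) => -[] []; rewrite /= -!exprD;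
  first [done | exact: i2 | exact: i4].
Qed.


End Swap.

End Reversal.

Section ReversalNetwork.

Variables (C : numClosedFieldType) (n : nat).
Implicit Types (M N : 'M[bool]_n) (s : 'S_n) (x : bits n).

Let pair := ('rV[bool]_n * 'rV[bool]_n)%type.

(** Reversing the rows gives a lower triangular matrix, whose determinant is the product of its
    diagonal. *)
Lemma antidiag_full N : row_full N ->
  (forall i j : 'I_n, N i j -> (i + j < n)%N) -> forall i, N i (rev_ord i).
Proof.
rewrite row_full_unit => unitN suppN i.
pose A := row_perm (perm (@rev_ord_inj n)) N.
have trigA : is_trig_mx A.
  apply/is_trig_mxP=> j k lt_jk; rewrite mxE permE.
  case: (boolP (N _ _)) => [/suppN /=|/negbTE //].
  by have := ltn_ord j; lia.
have: A \in unitmx by rewrite /A row_permE unitmx_mul unitmx_perm.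
rewrite unitmxE (det_trig trigA) unitfE => /prodf_neq0/(_ (rev_ord i) isT).
by rewrite mxE permE rev_ordK; case: (N _ _).
Qed.

(** Both sides have the same sum over all [i], so every inequality is an equality. *)
Lemma perm_ge_id s : (forall i : 'I_n, i <= s i)%N -> s = 1%g.
Proof.
move=> le_s; apply/permP=> i; rewrite perm1; apply/val_inj/esym/eqP.
have le_sum := leqif_sum (fun (j : 'I_n) (_ : xpredT j) => leqif_eq (le_s j)).
have: (\sum_(j < n) j = \sum_(j < n) s j)%N by apply: (reindex_perm s).
move/eqP; rewrite le_sum.2 => /forallP; exact.
Qed.

Lemma app1 x : app 1%:M x = x.
Proof.
apply/ffunP=> i; rewrite ffunE /dot (bigD1 i) //= big1 => [|j /negPf ne_ji].
  by rewrite !mxE eqxx mul1r addr0.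
by rewrite !mxE eq_sym ne_ji mul0r.
Qed.

(** The states go from [N] to the identity and the circuit goes back. They are independent of [c],
    so one list [L] serves all exponents. *)
Lemma reverse_network N : row_full N ->
  (forall i j : 'I_n, N i j -> (i + j < n)%N) ->
  exists2 L : seq pair,
    forall i j : 'I_n, (i < j)%N ->
      exists2 p, p \in L & pivot p.1 j /\ pivot p.2 i
  & forall c, exists t,
    [/\ all (allowed (@lnn n)) t, fits t (3 * n)
      & forall x, run t x = app N x /\ phase C t x = pair_phase C L c x].
Proof.
move=> fullN suppN.
pose T := ('M[bool]_n * 'S_n * seq pair)%type.
pose inv (st : T) := rothe st.1.1 st.1.2 /\ met st.2 st.1.2.
pose sem (st1 : T) (s : (pair -> nat) -> seq (gate n)) (st2 : T) := forall c x,
  app st1.1.1 x = run (s c) (app st2.1.1 x) /\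
  pair_phase C st2.2 c x = phase C (s c) (app st2.1.1 x) * pair_phase C st1.2 c x.
pose rev_perm := perm (@rev_ord_inj n).
have inv0 : inv (N, rev_perm, [::]).
  split; last first.
    move=> i r lt_ir; rewrite /= !permE /=; lia.
  split=> [i|i r]; rewrite /= !permE; first exact: antidiag_full.
  by move/suppN => /=; have := ltn_ord r; lia.
have [||st J k leJn|st J k|[[M s] L] p q def_q [rotheM metL]|//|
    [[M s] L] [t [[rotheM metL] semN tP small]]] :=
  @network_sorts n T (pair -> nat) inv sem (fun st => small_labels st.1.2) 3
    _ _ _ _ _ (N, rev_perm, [::]).
- by move=> st c x; rewrite mul1r.
- move=> st1 st2 st3 s1 s2 sem1 sem2 c x.
  have [run1 ph1] := sem1 c x; have [run2 ph2] := sem2 c x.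
  by rewrite run_cat phase_cat -run2 ph2 ph1 mulrA.
- exact: small_labels_leq_threshold.
- exact: small_labels_leq_suffix.
- have [lt_s|le_s] := ltnP (s q) (s p); last first.
    exists (M, s, L), (fun=> [::]); split=> //= [c x|J _].
      by rewrite mul1r.
    rewrite (small_labelsS _ _ p) -def_q (small_labelsS _ _ q).
    have ne_s : s p != s q :> nat.
      by rewrite val_eqE (inj_eq perm_inj) -val_eqE /= def_q; lia.
    by case: (ltnP (s p) J); case: (ltnP (s q) J); lia.
  (* A pair already in [L] contributes nothing new because of [undup], and only the parity of an
     exponent of -1 matters. *)
  pose w := (row p M, row q M); pose f c := (w \notin L) && odd (c w).
  have circ c := swap_gates_correct C def_q M (M p (s q)) (f c).
  exists (set_rows M p q (row q M) (row p M + M p (s q) *: row q M),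
    (tperm p q * s)%g, w :: L).
  exists (fun c => swap_gates p q (M p (s q)) (f c)); split.
  - by split; [apply: rothe_swap | apply: met_swap].
  - move=> c x; have [_ _ _ /(_ x)[run_x phase_x]] := circ c.
    split=> //; rewrite phase_x /f /pair_phase /=; case: (w \in L) => /=.
      by rewrite muln0 mul1r.
    rewrite big_cons; congr (_ * _).
    by case: (dot _ x && _); rewrite ?mul1n ?mul0n // signr_odd.
  - by move=> c; have [] := circ c.
  - move=> J _ /=; rewrite (small_labelsS _ _ p) -def_q !(small_labelsS _ _ q).
    rewrite permM tpermR small_labels_swap //; last lia.
    by case: (ltnP (s p) J); case: (ltnP (s q) J); lia.
  - by move=> J k; apply: small_labels_swap.
(* The sorted bound with [J = k = i] excludes labels below [i] from position [i]. *)
have s1 : s = 1%g.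
  apply: perm_ge_id => i; have lt_in := ltn_ord i.
  have := small i i (ltnW lt_in); rewrite subnn leqn0 sum_nat_eq0.
  by move=> /forall_inP/(_ i (leqnn i)); rewrite eqb0 -leqNgt.
(* For the identity permutation, [rothe] confines nonzero entries to [i <= j] and [j <= i]. *)
have M1 : M = 1%:M.
  apply/matrixP=> i j; rewrite mxE.
  have [diagM supM] := rotheM; rewrite /= s1 in diagM supM.
  have [<-|ne_ij] := eqVneq i j; first by have := diagM i; rewrite perm1.
  have := supM i j; rewrite !perm1 => sup_ij.
  case: (boolP (M i j)) => [/sup_ij|/negbTE //].
  by rewrite -eqn_leq => /eqP/val_inj eq_ij; rewrite eq_ij eqxx in ne_ij.
exists L => [i j lt_ij|c].
  by have := metL i j; rewrite /= s1 !perm1; apply.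
exists (t c); have [al fit] := tP c; split=> // x.
have [] := semN c x; rewrite /= M1 app1 => -> ->.
by rewrite /pair_phase big_nil mulr1.
Qed.


End ReversalNetwork.

(** * Phases *)

Section Phases.

Variables (C : numClosedFieldType) (n : nat).
Implicit Types (M : 'M[bool]_n) (x : bits n) (u v : 'rV[bool]_n).

Definition gate_lin (g : gate n) M :=
  if g is CNOT c t then set_rows M t t (row c M + row t M) 0 else M.

Lemma gate_run_app g M x : gate_run g (app M x) = app (gate_lin g M) x.
Proof.
case: g => //= c t; apply/ffunP=> k; rewrite ffunE app_set_rows dotD.
by case: eqP => _; rewrite ?ffunE.
Qed.

Lemma row_full_gate_lin g M :
  allowed (@all_to_all n) g -> row_full M -> row_full (gate_lin g M).
Proof.
case: g => //= c t ne_ct; rewrite -!sub1mx => /submx_trans; apply.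
set M' := set_rows _ _ _ _ _; have rowE r : r != t -> row r M = row r M'.
  by move=> /negPf ne_rt; rewrite row_set_rows ne_rt.
apply/row_subP=> r; have [->{r}|/rowE->] := eqVneq r t; last exact: row_sub.
have -> : row t M = row t M' + row c M'.
  rewrite -(rowE c) // row_set_rows eqxx addrC addrA.
  by apply/rowP=> j; rewrite !mxE; do 2!case: (M _ _).
by rewrite addmx_sub ?row_sub.
Qed.

Lemma run_linear s M : all (allowed (@all_to_all n)) s -> row_full M ->
  exists2 M', row_full M' & forall x, run s (app M x) = app M' x.
Proof.
elim: s M => [|g s IHs] M /=; first by exists M.
move=> /andP[al_g al_s] fullM.
have [M' fullM' run_s] := IHs _ al_s (row_full_gate_lin al_g fullM).
by exists M' => // x; rewrite gate_run_app run_s.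
Qed.

Lemma sign_dot u v x : (-1) ^+ (dot u x && dot v x) =
  \prod_(a : 'I_n * 'I_n)
     (-1) ^+ ((u 0 a.1 && v 0 a.2) && (x a.1 && x a.2)) :> C.
Proof.
have -> : dot u x && dot v x =
    \sum_(a : 'I_n * 'I_n) ((u 0 a.1 && v 0 a.2) && (x a.1 && x a.2)).
  rewrite -[LHS]/(dot u x * dot v x) big_distrlr pair_bigA /=.
  by apply: eq_bigr => a _; apply: andbACA.
by apply: (big_morph (fun b : bool => (-1) ^+ b)) => // b c; apply: signr_addb.
Qed.

Section MultiplicativeClass.

(** Stands for the phases obtainable from an initial layer of Phase gates and a reversing
    network. *)
Variable P : (bits n -> C) -> Prop.
Hypothesis P_eq : forall f g, f =1 g -> P f -> P g.
Hypothesis P1 : P (fun=> 1).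
Hypothesis PM : forall f g, P f -> P g -> P (fun x => f x * g x).
Hypothesis Pi : forall j, P (fun x => 'i ^+ x j).
Hypothesis P_met : forall i j : 'I_n, (i < j)%N ->
  exists p : 'rV[bool]_n * 'rV[bool]_n, [/\ pivot p.1 j, pivot p.2 i
    & P (fun x => (-1) ^+ (dot p.1 x && dot p.2 x))].

Lemma P_prod (I : Type) (r : seq I) (Q : pred I) (F : I -> bits n -> C) :
  (forall i, Q i -> P (F i)) -> P (fun x => \prod_(i <- r | Q i) F i x).
Proof.
move=> PF; elim: r => [|i r IHr].
  by apply: P_eq P1 => x; rewrite big_nil.
have [Qi|nQi] := boolP (Q i).
  by apply: P_eq (PM (PF i Qi) IHr) => x; rewrite big_cons Qi.
by apply: P_eq IHr => x; rewrite big_cons (negPf nQi).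
Qed.

Lemma P_sign_and (i j : 'I_n) : P (fun x => (-1) ^+ (x i && x j)).
Proof.
have [m] := ubnP (i + j); elim: m i j => // m IHm i j le_m.
wlog le_ij : i j le_m / (i <= j)%N => [IHij|].
  have [le_ij|/ltnW le_ji] := leqP i j; first exact: IHij.
  have le_m' : (j + i < m.+1)%N by rewrite addnC.
  by apply: P_eq (IHij j i le_m' le_ji) => x; rewrite andbC.
have [<-|ne_ij] := eqVneq i j.
  apply: P_eq (PM (Pi i) (Pi i)) => x; rewrite andbb.
  by case: (x i); rewrite ?mulr1 // -expr2 sqrCi.
have lt_ij : (i < j)%N by rewrite ltn_neqAle val_eqE ne_ij.
have [[u v] /= [[uj le_j] [vi le_i] Puv]] := P_met lt_ij.
pose F (a : 'I_n * 'I_n) x : C :=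
  (-1) ^+ ((u 0 a.1 && v 0 a.2) && (x a.1 && x a.2)).
have PF : P (fun x => \prod_(a | a != (j, i)) F a x).
  apply: P_prod => -[a b] ne_ab; rewrite /F /=.
  case: (boolP (u 0 a)) => [/le_j le_aj|_] //=.
  case: (boolP (v 0 b)) => [/le_i le_bi|_] //=.
  apply: IHm; move: ne_ab; rewrite xpair_eqE -!val_eqE /=; lia.
(* Every factor of [F] is a sign, so multiplying by the product over the other pairs cancels them
   and isolates [(j, i)]. *)
apply: P_eq (PM Puv PF) => x.
rewrite sign_dot (bigD1 (j, i)) //= -mulrA -big_split /= uj vi big1 ?mulr1.
  by rewrite [x i && _]andbC.
by move=> a _; rewrite /F; case: (_ && _); rewrite ?mulr1 ?mulrNN ?mulr1.
Qed.

Lemma P_i_dot u : P (fun x => 'i ^+ dot u x).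
Proof.
(* This is the correction term when [x a] is added to a partial sum of the form. *)
have PFand (a : 'I_n) (r : seq 'I_n) :
    P (fun x => (-1) ^+ (x a && \sum_(b <- r) u 0 b * x b)).
  elim: r => [|b r IHr].
    by apply: P_eq P1 => x; rewrite big_nil andbF.
  have Pb : P (fun x => (-1) ^+ (x a && (u 0 b && x b))).
    case: (u 0 b) => /=; first exact: P_sign_and.
    by apply: P_eq P1 => x; rewrite andbF.
  apply: P_eq (PM Pb IHr) => x; rewrite big_cons -signr_addb -andb_addr.
  by [].
rewrite /dot; elim: (index_enum _) => [|a r IHr].
  by apply: P_eq P1 => x; rewrite big_nil.
case: (boolP (u 0 a)) => [ua|/negPf ua]; last first.
  by apply: P_eq IHr => x; rewrite big_cons ua mul0r add0r.
apply: P_eq (PM (PM (Pi a) IHr) (PFand a r)) => x.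
rewrite big_cons ua mul1r.
have sqr_i : 'i * 'i = -1 :> C by rewrite -expr2 sqrCi.
case: (x a) (\sum_(b <- r) _) => -[]; rewrite /= ?mulr1 ?mul1r //.
by rewrite sqr_i mulrNN mulr1.
Qed.

(** Every wire carries a linear form throughout; a CZ on forms [a] and [b] contributes
    [i^a i^b i^(3 (a xor b))]. *)
Lemma P_phase s M : P (fun x => phase C s (app M x)).
Proof.
elim: s M => [|g s IHs] M /=; first exact: P1.
have Prow q : P (fun x => 'i ^+ app M x q).
  by apply: P_eq (P_i_dot (row q M)) => x; rewrite ffunE.
apply: (@P_eq (fun x => gate_phase C g (app M x) *
                        phase C s (app (gate_lin g M) x))).
  by move=> x; rewrite gate_run_app.
apply: PM; last exact: IHs.
case: g => [q|q r|//] /=; first exact: Prow.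
have Pqr := P_i_dot (row q M + row r M).
apply: P_eq (PM (PM (Prow q) (Prow r)) (PM Pqr (PM Pqr Pqr))) => x.
rewrite dotD !ffunE; have sqr_i : 'i * 'i = -1 :> C by rewrite -expr2 sqrCi.
case: (dot _ x) (dot _ x) => -[]; rewrite /= ?mulr1 ?mul1r //.
  by rewrite mulrA !sqr_i mulrNN mulr1.
by rewrite mulrA !sqr_i mulrNN mulr1.
Qed.

End MultiplicativeClass.

Definition phase_layer (a : 'I_n -> nat) (r : seq 'I_n) : seq (gate n) :=
  flatten [seq nseq (a j) (Phase j) | j <- r].

Lemma run_phase_layer a r x : run (phase_layer a r) x = x.
Proof. by elim: r => //= j r IHr; rewrite run_cat run_nseq_Phase. Qed.

Lemma phase_phase_layer a r x :
  phase C (phase_layer a r) x = \prod_(j <- r) 'i ^+ (x j * a j)%N.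
Proof.
elim: r => [|j r IHr]; rewrite ?big_nil //= big_cons phase_cat.
by rewrite run_nseq_Phase phase_nseq_Phase IHr.
Qed.

Lemma phase_layer_local a r :
  all (allowed (@lnn n)) (phase_layer a r) /\ fits (phase_layer a r) 0.
Proof.
have [all_a count_a] : all (allowed (@lnn n)) (phase_layer a r) /\
    count (@two_qubit n) (phase_layer a r) = 0%N.
  elim: r => [|j r [allr countr]] //=.
  by rewrite all_cat allr count_cat countr all_nseq count_nseq /= orbT.
by split=> //; rewrite -count_a; apply: fits_count.
Qed.

End Phases.

Theorem theorem1 (R : realType) (n : nat) (hn : (1 <= n)%N)
    (U : 'M[R[i]]_#|{: bits n}|) :
  hadamard_free_clifford U ->
  exists s : seq (gate n),
    [/\ all (allowed (@lnn n)) s, implements s U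
      & (two_qubit_depth s <= 5 * n)%N].
Proof.
case=> _ [s0 al0 <-].
have full1 : row_full (1%:M : 'M[bool]_n) by rewrite -sub1mx.
have [M fullM run0] := run_linear al0 full1.
have [N [s1 [al1 fit1 sem1 fullN suppN]]] := triangularize R[i] fullM.
have [L metL netN] := reverse_network R[i] fullN suppN.
(* As [L] is fixed before the exponents, multiplying two such functions adds their exponents. *)
pose P (f : bits n -> R[i]) := exists a c, forall x,
  f x = \prod_(j < n) 'i ^+ (x j * a j)%N * pair_phase R[i] L c x.
have P1 : P (fun=> 1).
  exists (fun=> 0%N), (fun=> 0%N) => x.
  by rewrite /pair_phase !big1 ?mulr1 // => *; rewrite muln0.
have PM f g : P f -> P g -> P (fun x => f x * g x).
  move=> [a [c fE]] [b [d gE]].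
  exists (fun j => a j + b j)%N, (fun p => c p + d p)%N => x.
  rewrite fE gE mulrACA -!big_split /=; congr (_ * _); apply: eq_bigr => k _;
    by rewrite mulnDr exprD.
have [a [c phase0]] : P (fun x => phase R[i] s0 (app 1%:M x)).
  apply: P_phase => //.
  - by move=> f g fg [a [c fE]]; exists a, c => x; rewrite -fg.
  - move=> j; exists (fun k => k == j : nat), (fun=> 0%N) => x.
    rewrite /pair_phase [X in _ * X]big1 ?mulr1 => [|p _]; last by rewrite muln0.
    rewrite (bigD1 j) //= eqxx muln1 big1 ?mulr1 // => k /negPf->.
    by rewrite muln0.
  - move=> i j lt_ij; have [p Lp [piv1 piv2]] := metL i j lt_ij.
    exists p; split=> //.
    exists (fun=> 0%N), (fun p' => p' == p : nat) => x.
    rewrite big1 ?mul1r => [|k _]; last by rewrite muln0.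
    rewrite /pair_phase (bigD1_seq p) ?mem_undup ?undup_uniq //= eqxx muln1.
    by rewrite big1 ?mulr1 // => p' /negPf->; rewrite muln0.
have [t [al2 fit2 sem2]] := netN c.
have [al3 fit3] := phase_layer_local a (index_enum 'I_n).
(* The Phase gates see the input bits, [t] produces [N] with the signs, and [s1] turns [N] into [M]
   without phase; the depths are 0, [3 * n] and [2 * n]. *)
exists (phase_layer a (index_enum _) ++ t ++ s1); split.
- by rewrite !all_cat al3 al2.
- apply: eq_circuit_mx => x; have [run2 phase2] := sem2 x.
    rewrite !run_cat run_phase_layer run2 -(sem1 x).1 -run0 app1; by [].
  rewrite !phase_cat run_phase_layer run2 (sem1 x).2 mulr1 phase2.
  by rewrite phase_phase_layer -phase0 app1.
apply: two_qubit_depth_leq.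
rewrite -[(5 * n)%N]/(0 + 5 * n)%N (mulnDl 3 2 n).
by do 2!apply: fits_cat => //.
Qed.
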